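(* Let $N$ be an even positive integer such that $N-1$ is an odd prime power, let $q$ be an even (positive) divisor of $N-2$ with $q\neq N-2$, let $x$ be a primitive element of $\mathrm{GF}(N-1)$, and let $T$ be a subset of $\mathbb{Z}_q$ of size $q/2$. Let $e$ be the smallest positive integer such that $T+e=T$. For $r\in\{0,\ldots,e-1\}$ and $a\in\mathrm{GF}(N-1)$ put $$S_{r,a}=\{x^{jq+i}+a : 0\le j\le (N-2)/q-1,\ i\in T+r\}.$$ Then the $e(N-1)$ sets $\{S_{r,a}: r=0,\ldots,e-1,\ a\in\mathrm{GF}(N-1)\}$ are distinct (distinct pairs $(r,a)$ give distinct sets) and constitute the blocks of a $\mathrm{BIBD}(N-1,\,e(N-1),\,N/2-1)$ with treatment set $\mathrm{GF}(N-1)$. Furthermore, if $(N-2)/q$ is odd and $U$ is a subset of size $e/2$ of $\{0,\ldots,e-1\}$ such that $U^*=U+(q/2)$, where $U^*$ is the complement of $U$ in $\{0,\ldots,e-1\}$ and the addition is reduced modulo $q$, then the $e(N-1)/2$ sets $\{S_{r,a}: r\in U,\ a\in\mathrm{GF}(N-1)\}$ constitute a BIBD with distinct blocks.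
   Context: $\mathrm{GF}(s)$ denotes a finite field with $s$ elements; a primitive element is a generator of its cyclic multiplicative group of nonzero elements. For a positive integer $q$, $\mathbb{Z}_q=\{0,1,\ldots,q-1\}$ with addition and multiplication reduced modulo $q$. For $T=\{a_1,\ldots,a_t\}\subseteq\mathbb{Z}_q$ and an integer $b$, $T+b=\{a_1+b,\ldots,a_t+b\}$, with elements reduced modulo $q$ to lie in $\{0,\ldots,q-1\}$. A $\mathrm{BIBD}(v,b,k)$ (balanced incomplete block design) is a family of $b$ blocks, each a $k$-element subset of a set of $v$ treatments, such that every treatment lies in the same number of blocks and every pair of distinct treatments is contained in the same number of blocks; it has distinct blocks if no block is repeated. *)

(* Defs.v *)
From mathcomp Require Import all_boot all_algebra all_fingroup all_solvable.

Set Implicit Arguments.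
Unset Strict Implicit.
Unset Printing Implicit Defensive.

Import GRing.Theory.
Local Open Scope ring_scope.

(* A design is a family of blocks, indexed by a finite type, so that repeated
   blocks are counted with multiplicity; the blocks are distinct exactly when
   the family is injective. *)
Definition is_BIBD (V I : finType) (B : I -> {set V}) (v b k : nat) : Prop :=
  [/\ #|V| = v,
      #|I| = b,
      forall i : I, #|B i| = k,
      exists rep : nat, forall s : V, #|[set i | s \in B i]| = rep
    & exists lambda : nat, forall s t : V, s != t ->
        #|[set i | (s \in B i) && (t \in B i)]| = lambda].

(* 'Z_q is the ring of integers modulo q only when 1 < q. *)
Definition translate (q : nat) (T : {set 'Z_q}) (b : nat) : {set 'Z_q} :=
  [set t + b%:R | t in T].

Definition is_least_period (q : nat) (T : {set 'Z_q}) (e : nat) : Prop :=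
  [/\ (0 < e)%N,
      translate T e = T
    & forall d : nat, (0 < d)%N -> translate T d = T -> (e <= d)%N].

(* The index i : 'Z_q enters the exponent through its representative in
   {0, ..., q - 1}. *)
Definition block (F : finFieldType) (N q : nat) (x : F) (T : {set 'Z_q})
    (r : nat) (a : F) : {set F} :=
  [set x ^+ (j * q + i)%N + a | j : 'I_((N - 2) %/ q),
                                i : 'Z_q in translate T r].

(* {0, ..., e - 1} viewed inside 'Z_q; for e the least period of a subset of
   'Z_q one has e <= q, and no two elements are identified. *)
Definition residues (q e : nat) (U : {set 'I_e}) : {set 'Z_q} :=
  [set (nat_of_ord u)%:R | u in U].

(* Main.v *)
Require Import Defs.
From mathcomp Require Import all_boot all_algebra all_fingroup all_solvable.
From mathcomp Require Import finfield.

(** Write [N - 1 = q * f + 1]; the block [S_(r,a)] is the translate by [a] of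
    the base block [D_r], the union of the cyclotomic classes of order [q]
    (the cosets of the subgroup generated by [x ^+ q]) whose index lies in
    [T + r].  Everything rests on two facts about the base blocks.

    Balance.  The translates of a family of sets of equal size form a BIBD as
    soon as every nonzero [d] has the same total number of representations as a
    difference inside a member of the family ([difference_family_BIBD]).
    Multiplication by [x] sends [D_r] to [D_(r+1)], and [D_e = D_0], so it
    permutes [D_0], ..., [D_(e-1)]; since the powers of [x] exhaust the nonzero
    elements, the total for [d] is the total for [1] ([differences_period]).

    Distinctness.  As [f > 1], multiplication by [x ^+ q <> 1] fixes [D_r], so
    the elements of [D_r] sum to [0] and those of [D_r + a] sum to
    [#|D_r| * a].  Because [2 * #|D_r| + 1] is the order of the field, this is
    [- a / 2]: the block determines [a], hence [D_r], hence [T + r], hence [r]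
    by minimality of the period ([block_inj]).

    Half family.  When [f] is odd, [-1 = x ^+ (f * (q / 2))] lies in the class
    of index [q / 2], so [- D_r = D_(r + q/2)].  A set and its negative have the
    same differences, so [U] and its complement [U + q/2] contribute equally
    ([sum_differences_half_turn]), and each accounts for half of the constant
    total. *)

Set Implicit Arguments.
Unset Strict Implicit.
Unset Printing Implicit Defensive.

Import GRing.Theory.
Local Open Scope ring_scope.

(** * Translates of a family of sets in an abelian group *)

Lemma eq_BIBD (V I : finType) (B B' : I -> {set V}) v b k :
  B =1 B' -> is_BIBD B v b k -> is_BIBD B' v b k.
Proof.
move=> BB' [cardV cardI cardB [rep repP] [lambda lambdaP]]; split=> //.
- by move=> i; rewrite -BB'.
- by exists rep => s; rewrite -(repP s); apply: eq_card => i; rewrite !inE BB'.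
- exists lambda => s t st; rewrite -(lambdaP s t st).
  by apply: eq_card => i; rewrite !inE BB'.
Qed.

Definition shift (V : finZmodType) (D : {set V}) (a : V) : {set V} :=
  [set y + a | y in D].

Definition differences (V : finZmodType) (D : {set V}) (d : V) : nat :=
  #|[set w in D | w + d \in D]|.

Section DifferenceFamilies.

Variable V : finZmodType.
Implicit Types (D : {set V}) (a d s t : V).

Lemma mem_shift D a s : (s \in shift D a) = (s - a \in D).
Proof.
apply/imsetP/idP => [[y yD ->]|sD]; first by rewrite addrK.
by exists (s - a); rewrite ?subrK.
Qed.

Lemma card_shift D a : #|shift D a| = #|D|.
Proof. by rewrite card_imset //; apply: addIr. Qed.

Lemma sum_shift D a :
  \sum_(y in shift D a) y = \sum_(y in D) y + a *+ #|D|.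
Proof.
by rewrite big_imset /=; [rewrite big_split sumr_const | move=> ? ? _ _ /addIr].
Qed.

Lemma mulrn_card (a : V) : a *+ #|V| = 0.
Proof. by rewrite -cardsT -FinRing.zmodXgE expg_cardG ?inE. Qed.

(** The substitution [w -> - (w + d)] exchanges the two ends of a difference. *)
Lemma differences_opp D D' d :
  (forall y, (- y \in D') = (y \in D)) -> differences D' d = differences D d.
Proof.
move=> DD'; pose h w := - (w + d).
have h_inj : injective h by move=> u w /oppr_inj/addIr.
rewrite /differences -[LHS](card_preimset _ h_inj); apply: eq_card => w.
by rewrite !inE /h DD' opprD subrK DD' andbC.
Qed.

Lemma card_pairs_slices (I : finType) (P : I -> V -> bool) :
  #|[set ia : I * V | P ia.1 ia.2]| = (\sum_i #|[set a | P i a]|)%N.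
Proof.
transitivity (\sum_i \sum_(a | P i a) 1)%N.
  rewrite (pair_big_dep xpredT P) -sum1_card.
  by apply: eq_bigl => ia; rewrite inE.
by apply: eq_bigr => i _; rewrite -sum1_card; apply: eq_bigl => a; rewrite inE.
Qed.

(** The translates of [D] containing both [s] and [t] correspond to the
    representations of [s - t] as a difference in [D], and those containing
    [s] to the elements of [D]. *)
Lemma difference_family_BIBD (I : finType) (D : I -> {set V}) (k lambda : nat) :
  (forall i, #|D i| = k) ->
  (forall d, d != 0 -> (\sum_i differences (D i) d)%N = lambda) ->
  is_BIBD (fun ia : I * V => shift (D ia.1) ia.2) #|V| (#|I| * #|V|) k.
Proof.
move=> cardD diffD; split=> //; first by rewrite card_prod.
- by move=> ia; rewrite card_shift.
- exists (#|I| * k)%N => s.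
  rewrite (card_pairs_slices (fun i a => s \in shift (D i) a)).
  rewrite -sum_nat_const; apply: eq_bigr => i _.
  have h_inj : injective (fun a => s - a) by move=> a b /addrI/oppr_inj.
  rewrite -(cardD i) -(card_preimset (D i) h_inj).
  by apply: eq_card => a; rewrite !inE mem_shift.
- exists lambda => s t st.
  rewrite (card_pairs_slices
             (fun i a => (s \in shift (D i) a) && (t \in shift (D i) a))).
  rewrite -(diffD (s - t)) ?subr_eq0 //; apply: eq_bigr => i _.
  have h_inj : injective (fun a => t - a) by move=> a b /addrI/oppr_inj.
  rewrite /differences -[RHS](card_preimset _ h_inj); apply: eq_card => a.
  by rewrite !inE !mem_shift andbC [t - a + _]addrC addrA subrK.
Qed.

End DifferenceFamilies.

(** * Translates of index sets and the least period *)

Section Translates.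

Variable q : nat.
Implicit Types (A T : {set 'Z_q}) (z : 'Z_q).

Lemma mem_translate A b z : (z \in translate A b) = (z - b%:R \in A).
Proof.
apply/imsetP/idP => [[y yA ->]|zA]; first by rewrite addrK.
by exists (z - b%:R); rewrite ?subrK.
Qed.

Lemma card_translate A b : #|translate A b| = #|A|.
Proof. by rewrite card_imset //; apply: addIr. Qed.

Lemma translateD A b c : translate A (b + c) = translate (translate A b) c.
Proof.
by apply/setP=> z; rewrite !mem_translate natrD opprD [- b%:R - _]addrC addrA.
Qed.

Lemma translate_inj b : injective (fun A => translate A b).
Proof. by apply: imset_inj; apply: addIr. Qed.

Lemma eq_translate A b c :
  b%:R = c%:R :> 'Z_q -> translate A b = translate A c.
Proof. by rewrite /translate => ->. Qed.

Lemma translate_modulus A : (1 < q)%N -> translate A q = A.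
Proof.
move=> q_gt1; apply/setP=> z; rewrite mem_translate.
by rewrite pchar_Zp // subr0.
Qed.

Lemma least_period_le T e : (1 < q)%N -> is_least_period T e -> (e <= q)%N.
Proof.
by move=> q_gt1 [_ _]; apply; [apply: ltnW | apply: translate_modulus].
Qed.

Lemma least_period_inj T e :
  is_least_period T e -> injective (fun r : 'I_e => translate T r).
Proof.
case=> _ _ leastT.
have ord_case (r s : 'I_e) : translate T r = translate T s -> (s <= r)%N.
  move=> rs; rewrite leqNgt; apply/negP=> lt_rs.
  have: (e <= s - r)%N.
    apply: leastT; first by rewrite subn_gt0.
    by apply: (@translate_inj r); rewrite /= -translateD subnK // ltnW.
  by rewrite leqNgt (leq_ltn_trans (leq_subr r s)).
move=> r s rs; apply: val_inj; apply/eqP; rewrite eqn_leq.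
by rewrite (ord_case s r) ?(ord_case r s).
Qed.

Lemma residues_inj e :
  (1 < q)%N -> (e <= q)%N -> injective (fun u : 'I_e => (u : nat)%:R : 'Z_q).
Proof.
move=> q_gt1 le_eq u v /(congr1 val); rewrite /= !val_Zp_nat //.
by rewrite !modn_small ?(leq_trans (ltn_ord _) le_eq) // => /val_inj.
Qed.

End Translates.

(** * Unions of cyclotomic classes *)

Definition cyclotomic_union (F : finFieldType) (q f : nat) (g : F)
    (A : {set 'Z_q}) : {set F} :=
  [set g ^+ (j * q + i)%N | j : 'I_f, i : 'Z_q in A].

Section CyclotomicClasses.

Variables (F : finFieldType) (q f : nat) (g : F).
Hypotheses (q_gt1 : (1 < q)%N) (g_prim : (q * f).-primitive_root g).
Hypothesis card_F : #|F| = (q * f).+1.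
Implicit Types (A T : {set 'Z_q}) (y d : F).

Local Notation D := (@cyclotomic_union F q f g).

Lemma class_index_lt (j : 'I_f) (i : 'Z_q) : (j * q + i < q * f)%N.
Proof.
have i_lt : (i < q)%N by rewrite -[ltnRHS](Zp_cast q_gt1).
apply: (@leq_trans (j * q + q)%N); first by rewrite ltn_add2l.
by rewrite -mulSnr mulnC leq_pmul2l ?(ltnW q_gt1).
Qed.

Lemma natr_class_index (j : nat) (i : 'Z_q) : (j * q + i)%:R = i :> 'Z_q.
Proof. by rewrite natrD natrM (pchar_Zp q_gt1) mulr0 add0r natr_Zp. Qed.

Lemma primitive_exponent y : y != 0 -> exists m, y = g ^+ m.
Proof.
move=> y0; have : y ^+ (q * f) = 1.
  have := expf_card y; rewrite card_F exprS => /(canRL (mulKf y0)) ->.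
  by rewrite mulVf.
by case/(prim_rootP g_prim) => i ->; exists i.
Qed.

Lemma primitive_neq0 : g != 0.
Proof.
apply/eqP=> g0; have := prim_expr_order g_prim.
by rewrite g0 expr0n gtn_eqF ?(prim_order_gt0 g_prim) // => /esym/eqP;
   rewrite oner_eq0.
Qed.

Lemma mem_cyclotomic_union A m : (g ^+ m \in D A) = (m%:R \in A).
Proof.
have q_gt0 := ltnW q_gt1; apply/imset2P/idP => [[j i _ iA /eqP]|mA].
  rewrite (eq_prim_root_expr g_prim) => /eqP mE.
  have {}mE : m = j * q + i %[mod q].
    by rewrite -(modn_dvdm m (dvdn_mulr f (dvdnn q))) mE modn_dvdm ?dvdn_mulr.
  suff -> : m%:R = i by [].
  rewrite -[RHS](natr_class_index j); apply: val_inj.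
  by rewrite /= !val_Zp_nat // mE.
have f_gt0 : (0 < f)%N.
  by have := prim_order_gt0 g_prim; rewrite muln_gt0 => /andP[].
have j_lt : ((m %/ q) %% f < f)%N by rewrite ltn_mod.
exists (Ordinal j_lt) (m%:R) => //=.
rewrite val_Zp_nat //; apply/eqP.
rewrite (eq_prim_root_expr g_prim).
rewrite {1}(divn_eq m q) eqn_modDr mulnC [(_ %% f * q)%N]mulnC -!muln_modr.
by rewrite modn_mod.
Qed.

Lemma zero_notin_cyclotomic_union A : 0 \notin D A.
Proof.
apply/imset2P=> -[j i _ _ /esym/eqP].
by rewrite expf_eq0 (negPf primitive_neq0) andbF.
Qed.

Lemma mem_mul_cyclotomic_union A m y :
  (g ^+ m * y \in D (translate A m)) = (y \in D A).
Proof.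
have [->|/primitive_exponent[n ->]] := eqVneq y 0.
  by rewrite mulr0 !(negPf (zero_notin_cyclotomic_union _)).
rewrite -exprD !mem_cyclotomic_union mem_translate natrD.
by rewrite [_ + n%:R]addrC addrK.
Qed.

Lemma cyclotomic_union_inj : injective (fun A => D A).
Proof.
move=> A B AB; apply/setP=> i.
by rewrite -[i]natr_Zp -!mem_cyclotomic_union AB.
Qed.

Lemma card_cyclotomic_union A : #|D A| = (f * #|A|)%N.
Proof.
have q_gt0 := ltnW q_gt1.
pose h (ji : 'I_f * 'Z_q) := g ^+ (ji.1 * q + ji.2)%N.
have -> : D A = [set h ji | ji in setX setT A].
  apply/setP=> y; apply/imset2P/imsetP => [[j i _ iA ->]|[[j i] jiP ->]].
    by exists (j, i); rewrite ?inE.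
  by exists j i => //; move: jiP; rewrite !inE.
rewrite card_imset ?cardsX ?cardsT ?card_ord // => -[j i] [l m] /eqP.
rewrite /h (eq_prim_root_expr g_prim) /=.
rewrite !modn_small ?class_index_lt // => /eqP jilm.
have im : i = m by rewrite -[i](natr_class_index j) jilm natr_class_index.
congr (_, _) => //; apply: val_inj; move/eqP: jilm.
by rewrite im eqn_add2r eqn_pmul2r // => /eqP.
Qed.

(** Multiplication by [g ^+ q], which is not [1], permutes the union. *)
Lemma sum_cyclotomic_union A : (1 < f)%N -> \sum_(y in D A) y = 0.
Proof.
move=> f_gt1; set c := g ^+ q; set s := LHS.
have c0 : c != 0 by rewrite expf_neq0 ?primitive_neq0.
have c1 : c != 1.
  rewrite -(prim_order_dvd g_prim) gtnNdvd ?(ltnW q_gt1) //.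
  by rewrite -[ltnLHS]muln1 ltn_pmul2l ?(ltnW q_gt1).
have : c * s = s.
  rewrite [in RHS]/s (reindex_inj (mulfI c0)) mulr_sumr.
  apply: eq_bigl => y.
  by rewrite -[in RHS](translate_modulus A q_gt1) mem_mul_cyclotomic_union.
move/eqP; rewrite -subr_eq0 -[X in _ - X]mul1r -mulrBl mulf_eq0 subr_eq0.
by rewrite (negPf c1) => /eqP.
Qed.

Lemma differences_translate A m d :
  differences (D (translate A m)) (g ^+ m * d) = differences (D A) d.
Proof.
have h_inj : injective ( *%R (g ^+ m)).
  by apply: mulfI; rewrite expf_neq0 ?primitive_neq0.
rewrite /differences -[LHS](card_preimset _ h_inj); apply: eq_card => w.
by rewrite !inE -mulrDr !mem_mul_cyclotomic_union.
Qed.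

(** As [translate T 0] and [translate T e] coincide, passing from [r] to
    [r + 1] permutes the summands; so the sum is constant along the powers
    of [g]. *)
Lemma differences_period T e d :
  translate T e = T -> d != 0 ->
  (\sum_(r < e) differences (D (translate T r)) d =
   \sum_(r < e) differences (D (translate T r)) 1%R)%N.
Proof.
case: e => [|e] Te; first by rewrite !big_ord0.
have T0 : translate T 0 = T.
  by apply/setP=> z; rewrite mem_translate subr0.
case/primitive_exponent=> m ->; elim: m => [|m <-]; first by rewrite expr0.
rewrite big_ord_recl [RHS]big_ord_recr /= T0 addnC; congr (_ + _)%N.
  apply: eq_bigr => r _; rewrite /bump /= [(1 + r)%N]addnC translateD exprS.
  by rewrite -[RHS](differences_translate _ 1%N) expr1.
rewrite -{1}Te -addn1 translateD -[RHS](differences_translate _ 1%N) expr1.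
by rewrite exprS.
Qed.

(** [-1] is [g] to half of the even order [q * f], and this exponent is
    congruent to [q / 2] modulo [q] when [f] is odd. *)
Lemma differences_half_turn A d :
  ~~ odd q -> odd f ->
  differences (D (translate A (q %/ 2))) d = differences (D A) d.
Proof.
move=> q_even f_odd; set h := (q %/ 2)%N.
have qE : q = (h * 2)%N by rewrite divnK // dvdn2.
have hfE : translate A (h * f)%N = translate A h.
  rewrite -(odd_double_half f) f_odd mulnDr muln1 -muln2 mulnCA -qE.
  rewrite [(_ * q)%N]mulnC [(h + _)%N]addnC translateD; congr translate.
  apply/setP=> z; rewrite mem_translate.
  by rewrite natrM pchar_Zp // mul0r subr0.
have gN1 : g ^+ (h * f) = -1.
  have : (g ^+ (h * f)) ^+ 2 == 1.
    by rewrite -exprM mulnAC -qE (prim_expr_order g_prim).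
  rewrite sqrf_eq1 -(prim_order_dvd g_prim) => /orP[|/eqP //].
  have hf0 : (0 < h * f)%N.
    by have := prim_order_gt0 g_prim; rewrite qE mulnAC muln_gt0 => /andP[].
  by rewrite qE mulnAC gtnNdvd // -[ltnLHS]muln1 ltn_pmul2l.
apply: differences_opp => y.
by rewrite -hfE -mulN1r -gN1 mem_mul_cyclotomic_union.
Qed.

(** The two sums correspond term by term under the half turn.  Since adding
    [q / 2] is done modulo [q], both sums are first reindexed by residues in
    ['Z_q], which [{0, ..., e - 1}] embeds into because [e <= q]. *)
Lemma sum_differences_half_turn T e (U W : {set 'I_e}) d :
  ~~ odd q -> odd f -> (e <= q)%N ->
  residues q W = translate (residues q U) (q %/ 2) ->
  (\sum_(r in W) differences (D (translate T r)) d =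
   \sum_(r in U) differences (D (translate T r)) d)%N.
Proof.
move=> q_even f_odd le_eq WU.
pose c (z : 'Z_q) := differences (D (translate T z)) d.
have cE (r : nat) : differences (D (translate T r)) d = c r%:R.
  by congr (differences (D _) d); apply: eq_translate; rewrite natr_Zp.
have c_half (z : 'Z_q) : c (z + (q %/ 2)%:R) = c z.
  rewrite -[RHS]differences_half_turn //; congr (differences (D _) d).
  by rewrite -translateD; apply: eq_translate; rewrite natrD !natr_Zp.
have sum_residues (X : {set 'I_e}) :
    (\sum_(r in X) differences (D (translate T r)) d =
     \sum_(z in residues q X) c z)%N.
  rewrite big_imset /=; first by apply: eq_bigr => r _; apply: cE.
  by move=> r s _ _; apply: residues_inj.
rewrite !sum_residues WU big_imset /=; last by move=> y z _ _ /addIr.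
exact: eq_bigr.
Qed.

(** With [s] the sum of the elements of the block, [s = #|D| * a] and
    [2 * #|D| + 1 = #|F|], so [a = - 2 * s] is determined by the block. *)
Lemma block_inj T e :
  (1 < f)%N -> (#|T| * 2 = q)%N -> is_least_period T e ->
  injective (fun ra : 'I_e * F => shift (D (translate T ra.1)) ra.2).
Proof.
move=> f_gt1 cardT periodT.
have sumE (r : 'I_e) a :
    (\sum_(y in shift (D (translate T r)) a) y) *+ 2 = - a.
  rewrite sum_shift sum_cyclotomic_union // add0r card_cyclotomic_union.
  rewrite card_translate -mulrnA -mulnA cardT mulnC.
  by apply/eqP; rewrite -addr_eq0 -mulrSr -card_F mulrn_card.
case=> [r a] [s b] /= rasb.
have ab : a = b by apply: oppr_inj; rewrite -(sumE r) rasb sumE.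
rewrite ab in rasb *; congr (_, _).
apply: (least_period_inj periodT); apply: cyclotomic_union_inj.
apply/setP=> y; move/setP/(_ (y + b)): rasb.
by rewrite !mem_shift addrK.
Qed.

End CyclotomicClasses.

Lemma blockE (F : finFieldType) (N q : nat) (x : F) (T : {set 'Z_q}) r a :
  block N x T r a =
  shift (cyclotomic_union ((N - 2) %/ q) x (translate T r)) a.
Proof.
apply/setP=> y; rewrite mem_shift; apply/imset2P/imset2P=> -[j i jP iP yE];
  exists j i => //; last by rewrite -yE subrK.
by rewrite yE addrK.
Qed.

Lemma generator_primitive_root (F : finFieldType) (x : {unit F}) :
  generator [set: {unit F}] x -> (#|F|.-1).-primitive_root (val x).
Proof.
move=> /eqP genx.
have ordx : #[x]%g = #|F|.-1 by rewrite orderE -genx card_finField_unit.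
rewrite -ordx /primitive_root_of_unity order_gt0 /=; apply/forallP=> i.
rewrite unity_rootE -FinRing.val_unitX -FinRing.val_unit1 val_eqE -order_dvdn.
apply/eqP; have [lt_i|] := ltnP i.+1 #[x]%g.
  by rewrite gtnNdvd // ltn_eqF.
move=> le_i; have -> : i.+1 = #[x]%g by apply/eqP; rewrite eqn_leq ltn_ord le_i.
by rewrite dvdnn eqxx.
Qed.

Theorem theorem2p2 (N : nat) (N_gt0 : (0 < N)%N) (N_even : ~~ odd N)
    (N1_odd : odd (N - 1))
    (N1_primepower : exists p k : nat,
       [/\ prime p, (0 < k)%N & (N - 1 = p ^ k)%N])
    (q : nat) (q_gt0 : (0 < q)%N) (q_even : ~~ odd q)
    (q_dvd : (q %| N - 2)%N) (q_neq : q <> (N - 2)%N)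
    (F : finFieldType) (card_F : #|F| = (N - 1)%N)
    (x : {unit F}) (x_primitive : generator [set: {unit F}] x)
    (T : {set 'Z_q}) (card_T : #|T| = (q %/ 2)%N)
    (e : nat) (e_period : is_least_period T e) :
  (let S := fun ra : 'I_e * F => block N (val x) T ra.1 ra.2 in
   injective S /\ is_BIBD S (N - 1) (e * (N - 1)) (N %/ 2 - 1))
  /\
  (odd ((N - 2) %/ q) ->
   forall U : {set 'I_e},
   (#|U| * 2 = e)%N ->
   residues q (~: U) = translate (residues q U) (q %/ 2) ->
   let S := fun ra : {r : 'I_e | r \in U} * F =>
              block N (val x) T (val ra.1) ra.2 in
   injective S
   /\ is_BIBD S (N - 1) ((e * (N - 1)) %/ 2) (N %/ 2 - 1)).
Proof.
have q_gt1 : (1 < q)%N by case: (q) q_gt0 q_even => [|[|]].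
have N_gt2 : (2 < N)%N.
  case: N1_primepower => p [k [p_prime k_gt0 NE]].
  have : (1 < N - 1)%N by rewrite NE -(exp1n k) ltn_exp2r // prime_gt1.
  by rewrite ltn_subRL.
set f := ((N - 2) %/ q)%N.
have qfE : (q * f = N - 2)%N by rewrite mulnC divnK.
have f_gt1 : (1 < f)%N.
  case: f qfE => [|[|//]]; last by rewrite muln1.
  by rewrite muln0 => /esym/eqP; rewrite subn_eq0 leqNgt N_gt2.
have cardFE : #|F| = (q * f).+1.
  by rewrite card_F qfE -subSn ?subSS // ltnW.
have g_prim : (q * f).-primitive_root (val x).
  by have := generator_primitive_root x_primitive; rewrite cardFE.
have cardT : (#|T| * 2 = q)%N by rewrite card_T divnK // dvdn2.
set D := fun r : nat => cyclotomic_union f (val x) (translate T r).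
have cardD r : #|D r| = (N %/ 2 - 1)%N.
  rewrite card_cyclotomic_union // card_translate.
  have N2 : (N %/ 2 * 2 = N)%N by rewrite divnK // dvdn2.
  apply/eqP; rewrite -(eqn_pmul2r (isT : (0 < 2)%N)) mulnBl N2 -qfE.
  by rewrite -mulnA cardT mulnC.
have [e_gt0 Te _] := e_period.
have S_inj : injective
    (fun ra : 'I_e * F => block N (val x) T ra.1 ra.2).
  move=> ra sb; rewrite !blockE.
  exact: (block_inj q_gt1 g_prim cardFE f_gt1 cardT e_period).
have total d : d != 0 ->
    (\sum_(r < e) differences (D r) d = \sum_(r < e) differences (D r) 1%R)%N.
  exact: differences_period.
split=> [S|f_odd U cardU compU S]; split.
- exact: S_inj.
- apply: (@eq_BIBD _ _ (fun ra : 'I_e * F => shift (D ra.1) ra.2)).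
    by move=> ra; rewrite /S blockE.
  rewrite -card_F -[X in (X * _)%N](card_ord e).
  apply: (difference_family_BIBD (D := fun r : 'I_e => D r) _ total) => r.
  exact: cardD.
- (* Restricting [r] to [U] keeps the injectivity of the whole family. *)
  move=> [r a] [s b] rasb.
  have [rs ->] : (val r, a) = (val s, b) by apply: S_inj.
  by congr (_, _); apply: val_inj.
apply: (@eq_BIBD _ _ (fun ra : {r : 'I_e | r \in U} * F =>
    shift (D (val ra.1)) ra.2)).
  by move=> ra; rewrite /S blockE.
have -> : ((e * (N - 1)) %/ 2 = #|{: {r : 'I_e | r \in U}}| * #|F|)%N.
  have -> : (e * (N - 1) = #|U| * (N - 1) * 2)%N by rewrite mulnAC cardU.
  by rewrite mulnK // card_sig card_F.
rewrite -card_F.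
have sumU d : (\sum_(r in ~: U) differences (D r) d =
               \sum_(r in U) differences (D r) d)%N.
  apply: (sum_differences_half_turn q_gt1 g_prim cardFE) => //.
  exact: least_period_le e_period.
apply: (difference_family_BIBD (D := fun r : {r | r \in U} => D (val r))
  (lambda := (\sum_(r < e) differences (D r) 1%R) %/ 2)) => [r|d d0].
  exact: cardD.
(* The total over all [r < e] is twice the sum over [U]. *)
rewrite -(big_sub U (fun r : 'I_e => differences (D r) d)) -(total d d0).
rewrite [in RHS](bigID (mem U)) /=.
rewrite [X in (_ + X)%N](eq_bigl (fun r => r \in ~: U)); last first.
  by move=> r; rewrite inE.
by rewrite sumU addnn -muln2 mulnK.
Qed.
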